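(* Consider the following trilinear operations, where $[u,v]=uv-vu$: $\omega_1(x,y,z) = xyz+yxz+zxy$ (fourth family, $q=-1$); $\omega_2(x,y,z) = xyz+xzy+yzx$ (fourth family, $q=2$); $\omega_3(x,y,z) = xyz+xzy+yxz$ (fourth family, $q=\tfrac12$); $\omega_4(x,y,z) = [x,yz]$ (cyclic commutator); $\omega_5(x,y,z) = xyz - xzy + 2yxz$ (weakly commutative operation); $\omega_6(x,y,z) = xyz+xzy-2yxz$ (weakly anticommutative operation); $\omega_7(x,y,z) = xyz+zyx$ (Jordan family, $q=\infty$). Then, as unital associative algebras, \[ U(A^{\omega_1})\cong U(A^{\omega_2})\cong U(A^{\omega_3})\cong U(A^{\omega_4})\cong U(A^{\omega_5})\cong U(A^{\omega_6})\cong U(A^{\omega_7}). \]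
   Context: $\mathbb{F}$ is a field of characteristic $0$. $A$ is the 2-dimensional space of $2\times 2$ matrices over $\mathbb{F}$ with zero diagonal, with basis $e_1 = \begin{bmatrix} 0&1\\0&0\end{bmatrix}$, $e_2 = \begin{bmatrix} 0&0\\1&0\end{bmatrix}$; it is closed under triple products $xyz$ of matrices. For a trilinear operation $\omega(x,y,z)$ (a fixed rational linear combination of the six products of $x,y,z$ in all orders), $A^\omega$ denotes the space $A$ with the trilinear operation $\omega$ computed using matrix multiplication. Let $\mathbb{F}\langle a,b\rangle$ be the free unital associative algebra and $\phi\colon A \to \mathbb{F}\langle a,b\rangle$ the linear map with $\phi(e_1)=a$, $\phi(e_2)=b$. The universal associative envelope is $U(A^\omega) = \mathbb{F}\langle a,b\rangle / I$, where $I$ is the two-sided ideal generated by the elements $\omega(\phi(x),\phi(y),\phi(z)) - \phi(\omega(x,y,z))$ for $x,y,z\in\{e_1,e_2\}$. *)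

(* Defs.v *)
From HB Require Import structures.
From mathcomp Require Import all_boot all_order all_algebra.
From mathcomp Require Import boolp finmap monalg.

Set Implicit Arguments.
Unset Strict Implicit.
Unset Printing Implicit Defensive.

Import GRing.Theory.
Local Open Scope ring_scope.
Local Open Scope quotient_scope.

(* [idealr] is a proper additive subgroup closed under u |-> a * u only, and  *)
(* ring_quotient.v only quotients commutative rings by it.                   *)
HB.mixin Record isRightAbsorbing (R : nzRingType) (S : R -> bool) := {
  right_absorbing_subproof : forall u v : R, u \in S -> u * v \in S
}.

#[short(type="bideal")]
HB.structure Definition BiIdeal (R : nzRingType) :=
  {S of Idealr R S & isRightAbsorbing R S}.

Section QuotientAlgebra.
Variables (K : comNzRingType) (R : algType K) (I : bideal R).

Lemma bidealMl (u v : R) : v \in I -> u * v \in I.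
Proof. exact: idealMr. Qed.

Lemma bidealMr (u v : R) : u \in I -> u * v \in I.
Proof. exact: right_absorbing_subproof. Qed.

Lemma bidealZ (c : K) (u : R) : u \in I -> c *: u \in I.
Proof. by move=> uI; rewrite -[u]mul1r scalerAl bidealMl. Qed.

Definition biquot : Type := Quotient.quot I.

HB.instance Definition _ := GRing.Zmodule.on biquot.
HB.instance Definition _ : EqQuotient R (Quotient.equiv I) biquot :=
  EqQuotient.on biquot.

Definition biquot_proj (x : R) : biquot := \pi_biquot x.

Lemma biquot_projE (x y : R) :
  (biquot_proj x = biquot_proj y) <-> (x - y \in I).
Proof. by rewrite Quotient.idealrBE; split=> [/eqP|/eqP]. Qed.

Lemma biquot_projK (q : biquot) : biquot_proj (repr q) = q.
Proof. exact: reprK. Qed.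

Lemma biquot_projB (x y : R) :
  biquot_proj (x - y) = biquot_proj x - biquot_proj y.
Proof.
rewrite /biquot_proj.
exact: (raddfB (\pi_(Quotient.quot I) : {additive R -> Quotient.quot I})).
Qed.

Lemma biquot_projD (x y : R) :
  biquot_proj (x + y) = biquot_proj x + biquot_proj y.
Proof.
rewrite /biquot_proj.
exact: (raddfD (\pi_(Quotient.quot I) : {additive R -> Quotient.quot I})).
Qed.

Lemma biquot_repr_proj (x : R) : repr (biquot_proj x) - x \in I.
Proof. by apply/biquot_projE; rewrite biquot_projK. Qed.

Definition biquot_one : biquot := biquot_proj 1.
Definition biquot_mul (p q : biquot) : biquot := biquot_proj (repr p * repr q).
Definition biquot_scale (c : K) (p : biquot) : biquot :=
  biquot_proj (c *: repr p).

Lemma biquot_mulE (x y : R) :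
  biquot_mul (biquot_proj x) (biquot_proj y) = biquot_proj (x * y).
Proof.
apply/biquot_projE; set x' := repr _; set y' := repr _.
have -> : x' * y' - x * y = x' * (y' - y) + (x' - x) * y.
  by rewrite mulrBr mulrBl addrA subrK.
by apply: rpredD; [apply: bidealMl | apply: bidealMr]; apply: biquot_repr_proj.
Qed.

Lemma biquot_scaleE (c : K) (x : R) :
  biquot_scale c (biquot_proj x) = biquot_proj (c *: x).
Proof.
apply/biquot_projE; rewrite -scalerBr.
exact/bidealZ/biquot_repr_proj.
Qed.

Lemma biquot_ind (P : biquot -> Prop) :
  (forall x, P (biquot_proj x)) -> forall q, P q.
Proof. by move=> Px q; rewrite -[q]biquot_projK. Qed.

Fact biquot_mulA : associative biquot_mul.
Proof.
by elim/biquot_ind=> x; elim/biquot_ind=> y; elim/biquot_ind=> z;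
   rewrite !biquot_mulE mulrA.
Qed.

Fact biquot_mul1l : left_id biquot_one biquot_mul.
Proof. by elim/biquot_ind=> x; rewrite biquot_mulE mul1r. Qed.

Fact biquot_mul1r : right_id biquot_one biquot_mul.
Proof. by elim/biquot_ind=> x; rewrite biquot_mulE mulr1. Qed.

Fact biquot_mulDl : left_distributive biquot_mul +%R.
Proof.
by elim/biquot_ind=> x; elim/biquot_ind=> y; elim/biquot_ind=> z;
   rewrite -biquot_projD !biquot_mulE mulrDl biquot_projD.
Qed.

Fact biquot_mulDr : right_distributive biquot_mul +%R.
Proof.
by elim/biquot_ind=> x; elim/biquot_ind=> y; elim/biquot_ind=> z;
   rewrite -biquot_projD !biquot_mulE mulrDr biquot_projD.
Qed.

Fact biquot_one_neq0 : biquot_one != 0.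
Proof.
rewrite -(subrr biquot_one) -biquot_projB subrr.
by apply/eqP => /biquot_projE; rewrite subr0 idealr1.
Qed.

HB.instance Definition _ := GRing.Zmodule_isNzRing.Build biquot
  biquot_mulA biquot_mul1l biquot_mul1r biquot_mulDl biquot_mulDr
  biquot_one_neq0.

Fact biquot_scaleA (c d : K) (p : biquot) :
  biquot_scale c (biquot_scale d p) = biquot_scale (c * d) p.
Proof. by elim/biquot_ind: p => x; rewrite !biquot_scaleE scalerA. Qed.

Fact biquot_scale1 : left_id 1 biquot_scale.
Proof. by elim/biquot_ind=> x; rewrite biquot_scaleE scale1r. Qed.

Fact biquot_scaleDr : right_distributive biquot_scale +%R.
Proof.
by move=> c; elim/biquot_ind=> x; elim/biquot_ind=> y;
   rewrite -biquot_projD !biquot_scaleE scalerDr biquot_projD.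
Qed.

Fact biquot_scaleDl (p : biquot) : {morph biquot_scale^~ p : c d / c + d}.
Proof.
by move=> c d; elim/biquot_ind: p => x;
   rewrite !biquot_scaleE scalerDl biquot_projD.
Qed.

HB.instance Definition _ := GRing.Zmodule_isLmodule.Build K biquot
  biquot_scaleA biquot_scale1 biquot_scaleDr biquot_scaleDl.

Fact biquot_scaleAl (c : K) (p q : biquot) : c *: (p * q) = (c *: p) * q.
Proof.
elim/biquot_ind: p => x; elim/biquot_ind: q => y.
by rewrite /GRing.scale /GRing.mul /= !(biquot_mulE, biquot_scaleE) scalerAl.
Qed.

HB.instance Definition _ := GRing.Lmodule_isLalgebra.Build K biquot
  biquot_scaleAl.

Fact biquot_scaleAr (c : K) (p q : biquot) : c *: (p * q) = p * (c *: q).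
Proof.
elim/biquot_ind: p => x; elim/biquot_ind: q => y.
by rewrite /GRing.scale /GRing.mul /= !(biquot_mulE, biquot_scaleE) scalerAr.
Qed.

HB.instance Definition _ := GRing.Lalgebra_isAlgebra.Build K biquot
  biquot_scaleAr.

Fact biquot_proj_is_zmod_morphism : zmod_morphism biquot_proj.
Proof. exact: biquot_projB. Qed.

Fact biquot_proj_is_monoid_morphism : monoid_morphism biquot_proj.
Proof. by split=> // x y; rewrite -biquot_mulE. Qed.

Fact biquot_proj_is_scalable : scalable biquot_proj.
Proof. by move=> c x; rewrite -biquot_scaleE. Qed.

HB.instance Definition _ := GRing.isZmodMorphism.Build R biquot biquot_proj
  biquot_proj_is_zmod_morphism.
HB.instance Definition _ := GRing.isMonoidMorphism.Build R biquot biquot_proj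
  biquot_proj_is_monoid_morphism.
HB.instance Definition _ := GRing.isScalable.Build K R biquot *:%R biquot_proj
  biquot_proj_is_scalable.

End QuotientAlgebra.

Section GeneratedIdeal.
Variable R : nzRingType.

(* The unit ideal is allowed here. *)
Definition two_sided_ideal (J : R -> Prop) : Prop :=
  [/\ J 0,
      forall x y, J x -> J y -> J (x - y),
      forall u x, J x -> J (u * x) &
      forall u x, J x -> J (x * u)].

Definition ideal_gen (G : R -> Prop) (x : R) : Prop :=
  forall J : R -> Prop,
    two_sided_ideal J -> (forall g, G g -> J g) -> J x.

Lemma ideal_gen_ideal (G : R -> Prop) : two_sided_ideal (ideal_gen G).
Proof.
split=> [J [J0 _ _ _] _ //|x y xI yI J JI GJ|u x xI J JI GJ|u x xI J JI GJ];
  have [_ JB Jl Jr] := JI.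
- by apply: JB; [apply: xI | apply: yI].
- by apply: Jl; apply: xI.
- by apply: Jr; apply: xI.
Qed.

Lemma ideal_gen_incl (G : R -> Prop) (g : R) : G g -> ideal_gen G g.
Proof. by move=> Gg J _; apply. Qed.

End GeneratedIdeal.

Definition alg_isom (K : comNzRingType) (U V : algType K) : Prop :=
  exists f : {lrmorphism U -> V}, bijective f.

(* F<a,b>, as the monoid algebra of the free monoid on two letters.           *)

Definition word_alg (F : fieldType) : Type := {malg F[{fmonom 'I_2}]}.

Section WordAlgebra.
Variable F : fieldType.

HB.instance Definition _ := GRing.Lalgebra.on (word_alg F).

Fact word_alg_scaleAr (c : F) (p q : word_alg F) :
  c *: (p * q) = p * (c *: q).
Proof.
have comm_const (g : {malg F[{fmonom 'I_2}]}) : g * c%:MP = c%:MP * g.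
  rewrite !malgM_def fgmulgU fgmulUg; apply: eq_bigr => k _.
  by rewrite mulm1 mul1m mulrC.
rewrite -[c *: (p * q)]mul_malgC -[c *: q]mul_malgC.
by rewrite [LHS]mulrA [RHS]mulrA -comm_const.
Qed.

HB.instance Definition _ := GRing.Lalgebra_isAlgebra.Build F (word_alg F)
  word_alg_scaleAr.

Definition word_letter (i : 'I_2) : word_alg F := mkmalgU (fmu i) 1.

Section Lift.
Variables (B : algType F) (v : 'I_2 -> B).

Definition word_eval (m : {fmonom 'I_2}) : B := \prod_(i <- m) v i.

Fact word_eval_mmorphism : mmorphism word_eval.
Proof.
by split=> [m n|]; rewrite /word_eval ?fmM ?fm1 ?big_cat ?big_nil.
Qed.
HB.instance Definition _ := isMultiplicative.Build {fmonom 'I_2} B word_eval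
  word_eval_mmorphism.

Definition word_lift (p : word_alg F) : B := mmap (in_alg B) word_eval p.

Fact word_lift_is_zmod_morphism : zmod_morphism word_lift.
Proof. exact: mmap_is_additive. Qed.

Fact word_lift_is_monoid_morphism : monoid_morphism word_lift.
Proof.
have comm_in (g : {malg F[{fmonom 'I_2}]}) m m' :
    GRing.comm (in_alg B g@_m) (word_eval m').
  by rewrite /GRing.comm /= -scalerAl -scalerAr mul1r mulr1.
have [liftM lift1] :=
  @commr_mmap_is_multiplicative _ _ _ (in_alg B) word_eval comm_in.
by split.
Qed.

Fact word_lift_is_scalable : scalable word_lift.
Proof. by move=> c p; rewrite /word_lift mmapZ /= -scalerAl mul1r. Qed.

HB.instance Definition _ := GRing.isZmodMorphism.Build (word_alg F) B word_lift
  word_lift_is_zmod_morphism.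
HB.instance Definition _ := GRing.isMonoidMorphism.Build (word_alg F) B word_lift
  word_lift_is_monoid_morphism.
HB.instance Definition _ := GRing.isScalable.Build F (word_alg F) B *:%R word_lift
  word_lift_is_scalable.

Lemma word_lift_letter i : word_lift (word_letter i) = v i.
Proof.
by rewrite /word_lift mmapU /= scale1r mul1r /word_eval fmU big_seq1.
Qed.

End Lift.
End WordAlgebra.

Record alg2gen (F : fieldType) :=
  Alg2Gen { alg2gen_alg :> algType F; alg2gen_gen : 'I_2 -> alg2gen_alg }.

(* Locked only so that unification does not unfold the operations of the      *)
(* monoid algebra.                                                           *)
HB.lock Definition free_alg2 (F : fieldType) : alg2gen F :=
  @Alg2Gen F (word_alg F) (@word_letter F).

Definition letter_a (F : fieldType) : free_alg2 F := alg2gen_gen (free_alg2 F) 0.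
Definition letter_b (F : fieldType) : free_alg2 F := alg2gen_gen (free_alg2 F) 1.

Lemma free_alg2_lift (F : fieldType) (B : algType F) (x y : B) :
  exists f : {lrmorphism free_alg2 F -> B},
    f (letter_a F) = x /\ f (letter_b F) = y.
Proof.
rewrite /letter_a /letter_b free_alg2.unlock /=.
exists (word_lift (fun i : 'I_2 => if i == 0 then x else y)).
by split; rewrite /= word_lift_letter.
Qed.

Record trilop := Trilop {
  coef_xyz : rat; coef_xzy : rat; coef_yxz : rat;
  coef_yzx : rat; coef_zxy : rat; coef_zyx : rat }.

(* [ratr] is the canonical embedding of the rationals into F when F has       *)
(* characteristic 0.                                                         *)
Definition trilop_eval (F : fieldType) (R : algType F) (w : trilop)
    (x y z : R) : R :=
    ratr (coef_xyz w) *: (x * y * z) + ratr (coef_xzy w) *: (x * z * y)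
  + ratr (coef_yxz w) *: (y * x * z) + ratr (coef_yzx w) *: (y * z * x)
  + ratr (coef_zxy w) *: (z * x * y) + ratr (coef_zyx w) *: (z * y * x).

Lemma lrmorph_trilop (F : fieldType) (R S : algType F)
    (f : {lrmorphism R -> S}) (w : trilop) (x y z : R) :
  f (trilop_eval w x y z) = trilop_eval w (f x) (f y) (f z).
Proof. by rewrite /trilop_eval !linearD /= !linearZ /= !rmorphM. Qed.

Lemma trilop_eval0 (F : fieldType) (R : algType F) (w : trilop) :
  trilop_eval w 0 0 0 = 0 :> R.
Proof. by rewrite /trilop_eval !mul0r !scaler0 !addr0. Qed.

(*                           xyz xzy yxz yzx zxy zyx *)
Definition omega1 := Trilop   1   0   1   0   1   0.
Definition omega2 := Trilop   1   1   0   1   0   0.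
Definition omega3 := Trilop   1   1   1   0   0   0.
Definition omega4 := Trilop   1   0   0 (- 1) 0   0.
Definition omega5 := Trilop   1 (- 1) 2   0   0   0.
Definition omega6 := Trilop   1   1 (- 2) 0   0   0.
Definition omega7 := Trilop   1   0   0   0   0   1.

Section OmegaFormulas.
Variables (F : fieldType) (R : algType F).
Implicit Types x y z : R.

Let ratr_simp :
  ((ratr 0 = 0 :> F) * (ratr 1 = 1 :> F) * (ratr 2 = 2 :> F)
   * (ratr (- 1) = - 1 :> F) * (ratr (- 2) = - 2 :> F))%type.
Proof.
have ratr_intE (n : int) : ratr n%:~R = n%:~R :> F by exact: ratr_int.
by do ![split]; [have:= ratr_intE 0 | have:= ratr_intE 1 | have:= ratr_intE 2
  | have:= ratr_intE (- 1) | have:= ratr_intE (- 2)].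
Qed.

Let simp := (ratr_simp, scale0r, scale1r, scaleN1r, scaleNr, add0r, addr0).

Lemma omega1E x y z :
  trilop_eval omega1 x y z = x * y * z + y * x * z + z * x * y.
Proof. by rewrite /trilop_eval /= !simp. Qed.

Lemma omega2E x y z :
  trilop_eval omega2 x y z = x * y * z + x * z * y + y * z * x.
Proof. by rewrite /trilop_eval /= !simp. Qed.

Lemma omega3E x y z :
  trilop_eval omega3 x y z = x * y * z + x * z * y + y * x * z.
Proof. by rewrite /trilop_eval /= !simp. Qed.

Lemma omega4E x y z :
  trilop_eval omega4 x y z = x * (y * z) - (y * z) * x.
Proof. by rewrite /trilop_eval /= !simp mulrA. Qed.

Lemma omega5E x y z :
  trilop_eval omega5 x y z = x * y * z - x * z * y + 2 * (y * x * z).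
Proof. by rewrite /trilop_eval /= !simp scaler_nat mulr_natl. Qed.

Lemma omega6E x y z :
  trilop_eval omega6 x y z = x * y * z + x * z * y - 2 * (y * x * z).
Proof. by rewrite /trilop_eval /= !simp scaler_nat mulr_natl. Qed.

Lemma omega7E x y z :
  trilop_eval omega7 x y z = x * y * z + z * y * x.
Proof. by rewrite /trilop_eval /= !simp. Qed.

End OmegaFormulas.

Section Envelope.
Variable F : fieldType.

Definition zero_diag : {pred 'M[F]_2} :=
  [pred M : 'M[F]_2 | [forall i, M i i == 0]].

Fact zero_diag_submod_closed : submod_closed zero_diag.
Proof.
split=> [|c M N /forallP M0 /forallP N0].
  by apply/forallP=> i; rewrite mxE.
by apply/forallP=> i; rewrite !mxE (eqP (M0 i)) (eqP (N0 i)) mulr0 addr0.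
Qed.
HB.instance Definition _ :=
  GRing.isSubmodClosed.Build F 'M[F]_2 zero_diag zero_diag_submod_closed.

Record zdiag_mx : predArgType :=
  ZDiag { zdiag_val :> 'M[F]_2; _ : zdiag_val \in zero_diag }.

HB.instance Definition _ := [isSub for zdiag_val].
HB.instance Definition _ := [Choice of zdiag_mx by <:].
HB.instance Definition _ := [SubChoice_isSubLmodule of zdiag_mx by <:].

Fact zdiag_in (M : zdiag_mx) : zdiag_val M \in zero_diag.
Proof. by case: M. Qed.

Fact zero_diag_delta (i j : 'I_2) : i != j -> delta_mx i j \in zero_diag.
Proof.
move=> ij; apply/forallP=> k; rewrite mxE.
by case: (k =P i) => [->|] //=; rewrite (negbTE ij).
Qed.

Definition e1 : zdiag_mx := ZDiag (@zero_diag_delta 0 1 isT).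
Definition e2 : zdiag_mx := ZDiag (@zero_diag_delta 1 0 isT).

Lemma zdiagP (M : zdiag_mx) : forall i, zdiag_val M i i = 0.
Proof. by case: M => M /= /forallP M0 i; apply/eqP. Qed.

Lemma zdiag_valE (c : F) (M N : zdiag_mx) i j :
  zdiag_val (c *: M + N) i j = c * zdiag_val M i j + zdiag_val N i j.
Proof. by rewrite /= !mxE. Qed.

Lemma zdiag_basis (M : zdiag_mx) :
  M = zdiag_val M 0 1 *: e1 + zdiag_val M 1 0 *: e2.
Proof.
apply/val_inj/matrixP=> i j; rewrite /= !mxE.
case: i j => [[|[|//]] hi] [[|[|//]] hj]; rewrite /= ?(mulr0, mulr1, addr0, add0r).
- by rewrite (_ : Ordinal hj = Ordinal hi) ?zdiagP //; apply: val_inj.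
- by congr (zdiag_val M _ _); apply: val_inj.
- by congr (zdiag_val M _ _); apply: val_inj.
- by rewrite (_ : Ordinal hj = Ordinal hi) ?zdiagP //; apply: val_inj.
Qed.

Fact zero_diag_mul3 (M N P : 'M[F]_2) :
  M \in zero_diag -> N \in zero_diag -> P \in zero_diag ->
  M * N * P \in zero_diag.
Proof.
move=> /forallP M0 /forallP N0 /forallP P0; apply/forallP=> i.
have z2 : forall Q : 'M[F]_2, (forall i, Q i i == 0) ->
    (Q ord0 ord0 = 0) * (Q (lift ord0 ord0) (lift ord0 ord0) = 0).
  by move=> Q Q0; split; apply/eqP.
have {M0 N0 P0} z := (z2 _ M0, z2 _ N0, z2 _ P0).
rewrite !mxE !big_ord_recl !big_ord0 !mxE !big_ord_recl !big_ord0.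
have [-> | ->] : i = ord0 \/ i = lift ord0 ord0.
- by case: i => [[|[|//]] hi]; [left | right]; apply: val_inj.
- by rewrite !z !(mul0r, mulr0, addr0, add0r).
- by rewrite !z !(mul0r, mulr0, addr0, add0r).
Qed.

Fact zdiag_trilop_subproof (w : trilop) (x y z : zdiag_mx) :
  trilop_eval w (val x) (val y) (val z) \in zero_diag.
Proof. by rewrite !rpredD // rpredZ // zero_diag_mul3 // zdiag_in. Qed.

(* The operation of the triple system A^w. *)
Definition zdiag_trilop (w : trilop) (x y z : zdiag_mx) : zdiag_mx :=
  ZDiag (zdiag_trilop_subproof w x y z).

Definition phi (M : zdiag_mx) : free_alg2 F :=
  zdiag_val M 0 1 *: letter_a F + zdiag_val M 1 0 *: letter_b F.

Fact phi_is_linear : linear phi.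
Proof.
have lin2 (V : lmodType F) (a b : V) (c s t u v : F) :
    (c * s + t) *: a + (c * u + v) *: b
    = c *: (s *: a + u *: b) + (t *: a + v *: b).
  by rewrite !scalerDl scalerDr !scalerA addrACA.
move=> c M N; rewrite /phi !zdiag_valE; exact: lin2.
Qed.
HB.instance Definition _ :=
  GRing.isLinear.Build F zdiag_mx (free_alg2 F) *:%R phi phi_is_linear.

Lemma phi_e1 : phi e1 = letter_a F.
Proof.
rewrite /phi.
have [-> ->] : zdiag_val e1 0 1 = 1 /\ zdiag_val e1 1 0 = 0 by rewrite !mxE.
by rewrite scale1r scale0r addr0.
Qed.

Lemma phi_e2 : phi e2 = letter_b F.
Proof.
rewrite /phi.
have [-> ->] : zdiag_val e2 0 1 = 0 /\ zdiag_val e2 1 0 = 1 by rewrite !mxE.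
by rewrite scale1r scale0r add0r.
Qed.

Section EnvelopeIdeal.
Variable w : trilop.

Definition env_relator (g : free_alg2 F) : Prop :=
  exists x y z : zdiag_mx,
    [/\ x \in [:: e1; e2], y \in [:: e1; e2], z \in [:: e1; e2] &
        g = trilop_eval w (phi x) (phi y) (phi z) - phi (zdiag_trilop w x y z)].

Definition env_ideal : {pred free_alg2 F} :=
  fun g => `[< ideal_gen env_relator g >].

Lemma env_idealE (g : free_alg2 F) :
  g \in env_ideal <-> ideal_gen env_relator g.
Proof. by split=> /asboolP. Qed.

Fact env_ideal_not1 : 1 \notin env_ideal.
Proof.
have [f [fa fb]] := free_alg2_lift (0 : F^o) (0 : F^o).
have f_phi M : f (phi M) = 0.
  by rewrite /phi linearD /= !linearZ /= fa fb !scaler0 addr0.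
apply/negP => /asboolP I1; suff /eqP : f 1 = 0 by rewrite rmorph1 oner_eq0.
apply: (I1 (fun p => f p = 0)); first split=> [|x y x0 y0|u x x0|u x x0].
- exact: rmorph0.
- by rewrite linearB /= x0 y0 subr0.
- by rewrite rmorphM /= x0 mulr0.
- by rewrite rmorphM /= x0 mul0r.
- move=> _ [x [y [z [_ _ _ ->]]]].
  by rewrite linearB /= lrmorph_trilop !f_phi trilop_eval0 subr0.
Qed.

Fact env_ideal_zmod_closed : zmod_closed env_ideal.
Proof.
have [I0 IB _ _] := ideal_gen_ideal env_relator.
split=> [|x y /asboolP xI /asboolP yI]; apply/asboolP => //; exact: IB.
Qed.
HB.instance Definition _ := GRing.isZmodClosed.Build (free_alg2 F) env_ideal
  env_ideal_zmod_closed.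

Fact env_ideal_proper :
  1 \notin env_ideal /\ (forall u v, v \in env_ideal -> u * v \in env_ideal).
Proof.
have [_ _ Il _] := ideal_gen_ideal env_relator.
split=> [|u v /asboolP vI]; first exact: env_ideal_not1.
by apply/asboolP; apply: Il.
Qed.
HB.instance Definition _ := isProperIdeal.Build (free_alg2 F) env_ideal
  env_ideal_proper.

Fact env_ideal_right_absorbing (u v : free_alg2 F) :
  u \in env_ideal -> u * v \in env_ideal.
Proof.
have [_ _ _ Ir] := ideal_gen_ideal env_relator.
by move=> /asboolP uI; apply/asboolP; apply: Ir.
Qed.
HB.instance Definition _ := isRightAbsorbing.Build (free_alg2 F) env_ideal
  env_ideal_right_absorbing.

Definition univ_env : algType F := biquot (env_ideal : bideal (free_alg2 F)).

End EnvelopeIdeal.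
End Envelope.

(* Main.v *)
Require Import Defs.
From HB Require Import structures.
From mathcomp Require Import all_boot all_order all_algebra.

(** All seven defining ideals coincide with the ideal generated by
    [a^2], [b^2], [aba - a], [bab - b].  That ideal contains the relators of
    every trilinear operation, because modulo it the product of three letters
    agrees with the product in [A].  Conversely, for each of the seven
    operations the relators with entries [x, x, y], in any order, give
    [xyx - x = l xxy] and [yxx = m xxy] with scalars [l != -1] and [m];
    computing
    [l xxyx] in two ways then gives [(1 + l) x^2 = (m - l^2) x^3 y], and either
    [m = l^2] or the relator with entries [x, x, x] gives [x^3 = 0]. *)

Set Implicit Arguments.
Unset Strict Implicit.
Unset Printing Implicit Defensive.

Import GRing.Theory.
Local Open Scope ring_scope.

(** * Cancellation, the two expansions, and quotients by equal ideals *)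

Lemma mulrn_inj_char0 (F : fieldType) (V : lmodType F) n :
  [pchar F] =i pred0 -> injective (fun v : V => v *+ n.+1).
Proof.
move=> charF0 u v; rewrite -!scaler_nat; apply: scalerI.
by rewrite (pcharf0P F).1.
Qed.

Lemma sandwich_square0 (F : fieldType) (R : algType F) (l m : F) (x y : R) :
    1 + l != 0 ->
    x * y * x = x + l *: (x * x * y) -> y * x * x = m *: (x * x * y) ->
    (m - l ^+ 2) *: (x * x * x) = 0 ->
  x * x = 0.
Proof.
move=> l1 xyx yxx cube0.
(* First expansion: the last three letters [x * y * x] are reduced. *)
have lhs : x * x * y * x = x * x + l *: (x * x * x * y).
  have -> : x * x * y * x = x * (x * y * x) by rewrite !mulrA.
  by rewrite xyx mulrDr -scalerAr !mulrA.
(* Second expansion: [l *: (x * x * y)] is traded for [x * y * x - x], then [y * x * x] is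
   reduced. *)
have rhs : l *: (x * x * y * x) = m *: (x * x * x * y) - x * x.
  apply: (canRL (addrK _)); rewrite addrC scalerAl -mulrDl -xyx.
  have -> : x * y * x * x = x * (y * x * x) by rewrite !mulrA.
  by rewrite yxx -scalerAr !mulrA.
apply: (scalerI l1); rewrite scaler0 scalerDl scale1r.
(* Zero is written as the value of [(1 + l) x^2] obtained by equating the two expansions. *)
have <- : (m - l ^+ 2) *: (x * x * x) * y = 0 by rewrite cube0 mul0r.
rewrite -scalerAl scalerBl.
move: rhs; rewrite lhs scalerDr scalerA -expr2 => /eqP.
rewrite -subr_eq opprK addrAC => /eqP <-.
by rewrite addrK addrC.
Qed.

(** The ideals agree only extensionally, so the quotient types differ. Passing through
    representatives is well defined because two of them differ by an element of both ideals. *)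
Lemma biquot_isom (K : comNzRingType) (R : algType K) (I J : bideal R) :
  I =i J -> alg_isom (biquot I) (biquot J).
Proof.
move=> eqIJ.
pose f (q : biquot I) : biquot J := biquot_proj J (repr q).
pose g (q : biquot J) : biquot I := biquot_proj I (repr q).
have fE x : f (biquot_proj I x) = biquot_proj J x.
  by apply/biquot_projE; rewrite -eqIJ biquot_repr_proj.
have gE x : g (biquot_proj J x) = biquot_proj I x.
  by apply/biquot_projE; rewrite eqIJ biquot_repr_proj.
have fB : zmod_morphism f.
  move=> p q; elim/biquot_ind: p => x; elim/biquot_ind: q => y.
  by rewrite -raddfB !fE raddfB.
have fM : monoid_morphism f.
  split; first by rewrite -(rmorph1 (biquot_proj I)) fE rmorph1.
  move=> p q; elim/biquot_ind: p => x; elim/biquot_ind: q => y.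
  by rewrite -rmorphM !fE rmorphM.
have fZ : scalable f.
  by move=> c; elim/biquot_ind=> x; rewrite -linearZ !fE linearZ.
pose fa := GRing.isZmodMorphism.Build _ _ f fB.
pose fm := GRing.isMonoidMorphism.Build _ _ f fM.
pose fs := GRing.isScalable.Build _ _ _ *:%R f fZ.
pose fL : {lrmorphism biquot I -> biquot J} := HB.pack f fa fm fs.
exists fL; exists g; elim/biquot_ind=> x /=.
  by rewrite fE gE.
by rewrite gE fE.
Qed.

(** * The triple product of A on its two matrix units *)

Section TripleSystem.
Variable F : fieldType.
Local Notation e1 := (e1 F).
Local Notation e2 := (e2 F).
Implicit Types (x y z : zdiag_mx F) (w : trilop).

(** A is closed under triple products but not under binary ones. *)
Definition zdiag_mul3 x y z : zdiag_mx F :=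
  ZDiag (zero_diag_mul3 (zdiag_in x) (zdiag_in y) (zdiag_in z)).

(** Symmetric in the two basis elements, so that one calculation serves for both letters. *)
Definition opposite_units x y : Prop :=
  (x = e1 /\ y = e2) \/ (x = e2 /\ y = e1).

Lemma opposite_units_sym x y : opposite_units x y -> opposite_units y x.
Proof. by case=> -[-> ->]; [right | left]. Qed.

Lemma opposite_units_basis x y : opposite_units x y ->
  x \in [:: e1; e2] /\ y \in [:: e1; e2].
Proof. by case=> -[-> ->]; rewrite !inE !eqxx ?orbT. Qed.

(** Each off-diagonal matrix unit squares to zero, and [E12 E21 E12 = E12]. *)
Lemma zdiag_mul3_units x y : opposite_units x y ->
  (zdiag_mul3 x x x = 0) * (zdiag_mul3 x x y = 0) *
  (zdiag_mul3 y x x = 0) * (zdiag_mul3 x y x = x).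
Proof.
by case=> -[-> ->]; do !split; apply: val_inj => /=;
  rewrite /GRing.mul /= !mul_delta_mx_cond /= ?mulr0n ?mulr1n
    ?(mul0mx, mulmx0, mul_delta_mx_cond).
Qed.

Lemma zdiag_trilopE w x y z :
  zdiag_trilop w x y z =
    ratr (coef_xyz w) *: zdiag_mul3 x y z + ratr (coef_xzy w) *: zdiag_mul3 x z y
  + ratr (coef_yxz w) *: zdiag_mul3 y x z + ratr (coef_yzx w) *: zdiag_mul3 y z x
  + ratr (coef_zxy w) *: zdiag_mul3 z x y + ratr (coef_zyx w) *: zdiag_mul3 z y x.
Proof. exact: val_inj. Qed.

Lemma zdiag_omega1E x y z : zdiag_trilop omega1 x y z =
  zdiag_mul3 x y z + zdiag_mul3 y x z + zdiag_mul3 z x y.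
Proof. exact/val_inj/omega1E. Qed.

Lemma zdiag_omega2E x y z : zdiag_trilop omega2 x y z =
  zdiag_mul3 x y z + zdiag_mul3 x z y + zdiag_mul3 y z x.
Proof. exact/val_inj/omega2E. Qed.

Lemma zdiag_omega3E x y z : zdiag_trilop omega3 x y z =
  zdiag_mul3 x y z + zdiag_mul3 x z y + zdiag_mul3 y x z.
Proof. exact/val_inj/omega3E. Qed.

Lemma zdiag_omega4E x y z : zdiag_trilop omega4 x y z =
  zdiag_mul3 x y z - zdiag_mul3 y z x.
Proof. by apply: val_inj; rewrite /= omega4E mulrA. Qed.

Lemma zdiag_omega5E x y z : zdiag_trilop omega5 x y z =
  zdiag_mul3 x y z - zdiag_mul3 x z y + zdiag_mul3 y x z *+ 2.
Proof. by apply: val_inj; rewrite /= omega5E mulr_natl. Qed.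

Lemma zdiag_omega6E x y z : zdiag_trilop omega6 x y z =
  zdiag_mul3 x y z + zdiag_mul3 x z y - zdiag_mul3 y x z *+ 2.
Proof. by apply: val_inj; rewrite /= omega6E mulr_natl. Qed.

Lemma zdiag_omega7E x y z : zdiag_trilop omega7 x y z =
  zdiag_mul3 x y z + zdiag_mul3 z y x.
Proof. exact/val_inj/omega7E. Qed.

(** * Linear maps from A that respect an operation *)

Section Representations.
Variables (R : algType F) (g : {linear zdiag_mx F -> R}).

(** Vanishing in [R] of the relators of [w], with [g] in place of [phi]. *)
Definition triple_rep w : Prop :=
  forall x y z, x \in [:: e1; e2] -> y \in [:: e1; e2] -> z \in [:: e1; e2] ->
  trilop_eval w (g x) (g y) (g z) = g (zdiag_trilop w x y z).

Definition unit_rep : Prop := forall x y, opposite_units x y ->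
  g x * g x = 0 /\ g x * g y * g x = g x.

(** Of the eight words of length three, six contain a square and vanish on both sides; [aba] and
    [bab] remain. So [g] preserves all triple products of basis elements, and hence their linear
    combinations. *)
Lemma unit_rep_triple w : unit_rep -> triple_rep w.
Proof.
move=> ug; have [aa aba] := ug e1 e2 (or_introl (conj erefl erefl)).
have [bb bab] := ug e2 e1 (or_intror (conj erefl erefl)).
have u12 : opposite_units e1 e2 by left.
have u21 := opposite_units_sym u12.
have gM x y z : x \in [:: e1; e2] -> y \in [:: e1; e2] ->
    z \in [:: e1; e2] -> g x * g y * g z = g (zdiag_mul3 x y z).
  by rewrite !inE => /orP[]/eqP-> /orP[]/eqP-> /orP[]/eqP->;
    rewrite ?(zdiag_mul3_units u12) ?(zdiag_mul3_units u21) ?linear0 //;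
    rewrite ?aa ?bb ?mul0r // -mulrA ?aa ?bb mulr0.
move=> x y z xB yB zB.
by rewrite zdiag_trilopE !linearD !linearZ -!gM.
Qed.

Hypothesis charF0 : [pchar F] =i pred0.

(** Each operation only has to supply [l] and [m]: once [x^2 = 0], the correction term in [x y x]
    disappears. *)
Lemma unit_repP (l m : F) : 1 + l != 0 ->
  (forall x y, opposite_units x y ->
    [/\ g x * g y * g x = g x + l *: (g x * g x * g y),
        g y * g x * g x = m *: (g x * g x * g y) &
        (m - l ^+ 2) *: (g x * g x * g x) = 0]) -> unit_rep.
Proof.
move=> l1 gP x y /gP[xyx yxx cube0].
have xx := sandwich_square0 l1 xyx yxx cube0.
by rewrite xyx xx mul0r scaler0 addr0.
Qed.

(** * The scalars [l] and [m] for each of the seven operations *)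

Lemma natf_neq0 n : n.+1%:R != 0 :> F.
Proof. by rewrite (pcharf0P F).1. Qed.

(** In the notation set in the proof, the entries [xxy], [xyx], [xxx] give [2p + r = 0],
    [q + r + p = X], [3s = 0]; hence [r = -2p] and [q = X + p]. *)
Lemma omega1_unit_rep : triple_rep omega1 -> unit_rep.
Proof.
move=> h; apply: (@unit_repP 1 (- 2)) => [|x y xy].
  by exact: (natf_neq0 1).
have [xB yB] := opposite_units_basis xy.
have := h x x x xB xB xB; have := h y x x yB xB xB.
have := h x y x xB yB xB; have := h x x y xB xB yB.
rewrite !omega1E !zdiag_omega1E !(zdiag_mul3_units xy).
rewrite !(addr0, add0r, mul0rn, sub0r, subr0, oppr0,
  linear0 g, linearN g, linearD g, linearMn g).
set s := g x * g x * g x; set p := g x * g x * g y.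
set q := g x * g y * g x; set r := g y * g x * g x; set X := g x.
move=> ppr qrp _ s3.
have rE : r = - (p + p) by rewrite -(addr0_eq ppr).
have s0 : s = 0.
  (* The factor cancelled is [n.+1], so [n := 2] divides by 3. *)
  by apply: (mulrn_inj_char0 (n := 2) charF0); rewrite mul0rn -s3 mulrSr mulr2n.
by rewrite s0 scaler0 -qrp rE scale1r opprD addrA !subrK scaleNr scaler_nat
  mulr2n -opprD.
Qed.

(** Entries [yxx] and [xyx] give [2r + p = 0] and [q + p + r = X], so [r = -p/2] and [q = X - p/2];
    [xxx] gives [3s = 0]. *)
Lemma omega2_unit_rep : triple_rep omega2 -> unit_rep.
Proof.
move=> h; apply: (@unit_repP (- 2^-1) (- 2^-1)) => [|x y xy].
  by rewrite subr_eq0 eq_sym invr_eq1 -subr_eq0 -[2]/(1 + 1) addrK oner_eq0.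
have [xB yB] := opposite_units_basis xy.
have := h x x x xB xB xB; have := h y x x yB xB xB.
have := h x y x xB yB xB; have := h x x y xB xB yB.
rewrite !omega2E !zdiag_omega2E !(zdiag_mul3_units xy).
rewrite !(addr0, add0r, mul0rn, sub0r, subr0, oppr0,
  linear0 g, linearN g, linearD g, linearMn g).
set s := g x * g x * g x; set p := g x * g x * g y.
set q := g x * g y * g x; set r := g y * g x * g x; set X := g x.
move=> _ qpr rrp s3.
have pE : p = - (r + r) by rewrite -(addr0_eq rrp).
have s0 : s = 0.
  by apply: (mulrn_inj_char0 (n := 2) charF0); rewrite mul0rn -s3 mulrSr mulr2n.
have rE : r = - 2^-1 *: p.
  rewrite pE scaleNr scalerN opprK -mulr2n -scaler_nat scalerA mulVf ?scale1r //.
  exact: (natf_neq0 1).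
by rewrite -rE s0 scaler0 -qpr pE opprD addrA !subrK.
Qed.

(** Entries [xxy] give [2p + q = X]; comparison with [q + p + r = X] from [xyx] leaves [r = p].
    Again [3s = 0]. *)
Lemma omega3_unit_rep : triple_rep omega3 -> unit_rep.
Proof.
move=> h; apply: (@unit_repP (- 2) 1) => [|x y xy].
  by rewrite -[2]/(1 + 1) opprD addrA subrr sub0r oppr_eq0 oner_eq0.
have [xB yB] := opposite_units_basis xy.
have := h x x x xB xB xB; have := h y x x yB xB xB.
have := h x y x xB yB xB; have := h x x y xB xB yB.
rewrite !omega3E !zdiag_omega3E !(zdiag_mul3_units xy).
rewrite !(addr0, add0r, mul0rn, sub0r, subr0, oppr0,
  linear0 g, linearN g, linearD g, linearMn g).
set s := g x * g x * g x; set p := g x * g x * g y.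
set q := g x * g y * g x; set r := g y * g x * g x; set X := g x.
move=> pqp qpr _ s3.
have rE : r = p by apply: (addrI (q + p)); rewrite qpr -pqp [p + q]addrC.
have s0 : s = 0.
  by apply: (mulrn_inj_char0 (n := 2) charF0); rewrite mul0rn -s3 mulrSr mulr2n.
by rewrite rE s0 scaler0 scale1r -pqp scaleNr scaler_nat mulr2n opprD addrA
  addrK addrC addKr.
Qed.

(** Entries [xyx] give [q - r = X] and [yxx] give [r = p]. The relator at [xxx] is trivial; the cube
    condition holds because [m = l^2]. *)
Lemma omega4_unit_rep : triple_rep omega4 -> unit_rep.
Proof.
move=> h; apply: (@unit_repP 1 1) => [|x y xy].
  by exact: (natf_neq0 1).
have [xB yB] := opposite_units_basis xy.
have := h x x x xB xB xB; have := h y x x yB xB xB.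
have := h x y x xB yB xB; have := h x x y xB xB yB.
rewrite !omega4E !zdiag_omega4E !(zdiag_mul3_units xy) !mulrA.
rewrite !(addr0, add0r, mul0rn, sub0r, subr0, oppr0,
  linear0 g, linearN g, linearD g, linearMn g).
set s := g x * g x * g x; set p := g x * g x * g y.
set q := g x * g y * g x; set r := g y * g x * g x; set X := g x.
move=> _ qr /eqP; rewrite subr_eq0 => /eqP rE _.
by rewrite -qr rE scale1r subrK expr1n subrr scale0r.
Qed.

(** Entries [yxx] give [2q = 2X]; then [3p - q = -X] from [xxy] kills [p], and [q - p + 2r = X] from
    [xyx] kills [r]. *)
Lemma omega5_unit_rep : triple_rep omega5 -> unit_rep.
Proof.
move=> h; apply: (@unit_repP 0 0) => [|x y xy].
  by rewrite addr0 oner_eq0.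
have [xB yB] := opposite_units_basis xy.
have := h x x x xB xB xB; have := h y x x yB xB xB.
have := h x y x xB yB xB; have := h x x y xB xB yB.
rewrite !omega5E !zdiag_omega5E !(zdiag_mul3_units xy) !mulr_natl.
rewrite !(addr0, add0r, mul0rn, sub0r, subr0, oppr0,
  linear0 g, linearN g, linearD g, linearMn g).
set s := g x * g x * g x; set p := g x * g x * g y.
set q := g x * g y * g x; set r := g y * g x * g x; set X := g x.
rewrite !subrr !add0r -mulr2n => pq qp qX s2.
have qE : q = X by apply: (mulrn_inj_char0 (n := 1) charF0).
have p0 : p = 0.
  apply: (mulrn_inj_char0 (n := 2) charF0); rewrite mul0rn mulrS.
  by apply: (addIr (- X)); rewrite add0r -[RHS]pq qE addrAC.
have r0 : r = 0.
  apply: (mulrn_inj_char0 (n := 1) charF0); rewrite mul0rn.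
  by apply: (addrI X); rewrite addr0 -{2}qp p0 qE subr0.
have s0 : s = 0.
  by apply: (mulrn_inj_char0 (n := 1) charF0); rewrite mul0rn -s2.
by rewrite s0 r0 qE !scale0r scaler0 addr0.
Qed.

(** Entries [xxy] give [q - p = X] and [xyx] give [q + p - 2r = X], so [r = p]. As for [omega4], the
    relator at [xxx] is trivial and [m = l^2]. *)
Lemma omega6_unit_rep : triple_rep omega6 -> unit_rep.
Proof.
move=> h; apply: (@unit_repP 1 1) => [|x y xy].
  by exact: (natf_neq0 1).
have [xB yB] := opposite_units_basis xy.
have := h x x x xB xB xB; have := h y x x yB xB xB.
have := h x y x xB yB xB; have := h x x y xB xB yB.
rewrite !omega6E !zdiag_omega6E !(zdiag_mul3_units xy) !mulr_natl.
rewrite !(addr0, add0r, mul0rn, sub0r, subr0, oppr0,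
  linear0 g, linearN g, linearD g, linearMn g).
set s := g x * g x * g x; set p := g x * g x * g y.
set q := g x * g y * g x; set r := g y * g x * g x; set X := g x.
move=> pq qp _ _.
have qE : q = X + p.
  by rewrite -pq mulr2n opprD addrA [p + q]addrC addrK subrK.
have rE : r = p.
  apply: (mulrn_inj_char0 (n := 1) charF0); move/eqP: qp.
  by rewrite subr_eq qE -addrA -mulr2n => /eqP/addrI/esym.
by rewrite rE qE expr1n subrr scale0r scale1r.
Qed.

(** Entries [xyx] give [2q = 2X] and [xxy] give [p + r = 0]. Here [m - l^2 = -1], so the cube must
    vanish: [xxx] gives [2s = 0]. *)
Lemma omega7_unit_rep : triple_rep omega7 -> unit_rep.
Proof.
move=> h; apply: (@unit_repP 0 (- 1)) => [|x y xy].
  by rewrite addr0 oner_eq0.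
have [xB yB] := opposite_units_basis xy.
have := h x x x xB xB xB; have := h y x x yB xB xB.
have := h x y x xB yB xB; have := h x x y xB xB yB.
rewrite !omega7E !zdiag_omega7E !(zdiag_mul3_units xy).
rewrite !(addr0, add0r, mul0rn, sub0r, subr0, oppr0,
  linear0 g, linearN g, linearD g, linearMn g).
set s := g x * g x * g x; set p := g x * g x * g y.
set q := g x * g y * g x; set r := g y * g x * g x; set X := g x.
rewrite -!mulr2n => pr qX _ s2.
have qE : q = X by apply: (mulrn_inj_char0 (n := 1) charF0).
have s0 : s = 0.
  by apply: (mulrn_inj_char0 (n := 1) charF0); rewrite mul0rn -s2.
by rewrite s0 qE scale0r scaler0 addr0 scaleN1r (addr0_eq pr).
Qed.

End Representations.

(** * Comparison of the envelopes through the canonical map of A *)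

Definition env_map w : zdiag_mx F -> univ_env F w :=
  biquot_proj (@env_ideal F w : bideal (free_alg2 F)) \o @phi F.

Fact env_map_is_linear w : linear (@env_map w).
Proof.
move=> c x y; rewrite /env_map /= (linearP (@phi F)).
exact: (linearP (biquot_proj _)).
Qed.
HB.instance Definition _ w := GRing.isLinear.Build F (zdiag_mx F) (univ_env F w)
  *:%R (@env_map w) (@env_map_is_linear w).

Lemma env_map_triple_rep w : triple_rep (@env_map w) w.
Proof.
move=> x y z xB yB zB; rewrite /env_map /= -lrmorph_trilop.
by apply/biquot_projE/env_idealE; apply: ideal_gen_incl; exists x, y, z.
Qed.

(** The kernel of the projection onto [univ_env F w'] is an ideal, so it is enough that it contains
    the relators of [w]. *)
Lemma env_ideal_sub w w' : triple_rep (@env_map w') w ->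
  {subset @env_ideal F w <= @env_ideal F w'}.
Proof.
move=> rep_w x /env_idealE/(_ (fun u => u \in @env_ideal F w')); apply.
  split=> [|u v|u v|u v]; [exact: rpred0|exact: rpredB|exact: idealMr|].
  exact: (@bidealMr F _ (@env_ideal F w' : bideal _)).
move=> _ [u [v [t [uB vB tB ->]]]].
apply/(biquot_projE (@env_ideal F w' : bideal _)).
by rewrite lrmorph_trilop; exact: rep_w.
Qed.

(** By [unit_rep_triple] each envelope kills the relators of the other operation, so the two ideals
    contain each other. *)
Lemma univ_env_isom w w' : unit_rep (@env_map w) -> unit_rep (@env_map w') ->
  alg_isom (univ_env F w) (univ_env F w').
Proof.
move=> uw uw'; apply: biquot_isom => x; apply/idP/idP; apply: env_ideal_sub;
  exact: unit_rep_triple.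
Qed.

End TripleSystem.

Theorem proposition5p10 (F : fieldType) (charF0 : [pchar F]%R =i pred0) :
  alg_isom (univ_env F omega1) (univ_env F omega2) /\
  alg_isom (univ_env F omega2) (univ_env F omega3) /\
  alg_isom (univ_env F omega3) (univ_env F omega4) /\
  alg_isom (univ_env F omega4) (univ_env F omega5) /\
  alg_isom (univ_env F omega5) (univ_env F omega6) /\
  alg_isom (univ_env F omega6) (univ_env F omega7).
Proof.
have u1 := omega1_unit_rep charF0 (@env_map_triple_rep F omega1).
have u2 := omega2_unit_rep charF0 (@env_map_triple_rep F omega2).
have u3 := omega3_unit_rep charF0 (@env_map_triple_rep F omega3).
have u4 := omega4_unit_rep charF0 (@env_map_triple_rep F omega4).
have u5 := omega5_unit_rep charF0 (@env_map_triple_rep F omega5).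
have u6 := omega6_unit_rep charF0 (@env_map_triple_rep F omega6).
have u7 := omega7_unit_rep charF0 (@env_map_triple_rep F omega7).
split; first exact: (univ_env_isom u1 u2).
split; first exact: (univ_env_isom u2 u3).
split; first exact: (univ_env_isom u3 u4).
split; first exact: (univ_env_isom u4 u5).
split; first exact: (univ_env_isom u5 u6).
exact: (univ_env_isom u6 u7).
Qed.
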